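(* Let $f:\mathbb{R}^d\to\mathbb{R}$ be convex and twice differentiable, and let $H>0$ be such that for all $x,y\in\mathbb{R}^d$ $$f(y)\le f(x)+\langle\nabla f(x),y-x\rangle+\tfrac12\langle\nabla^2 f(x)(y-x),y-x\rangle+\tfrac H3\|y-x\|^3,\qquad \|\nabla f(y)-\nabla f(x)-\nabla^2 f(x)(y-x)\|\le H\|y-x\|^2 .$$ Let $x^0\in\mathbb{R}^d$, let $x^*$ be a minimizer of $f$, and assume the sublevel set $\{x:\ f(x)\le f(x^0)\}$ is bounded. Let $(x^k)_{k\ge1}$ be generated by the Accelerated Casual Cubic Newton method (AccCaCuN) started at $x^0$, with constants $0<M_k\le H$ ($k\ge0$) and $N=12H$. Then for all $k\ge1$ $$f(x^k)-f(x^* )\le\frac{14\cdot 2H\,\|x^0-x^*\|^3}{k(k+1)(k+2)}.$$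
   Context: $\|\cdot\|$ is the Euclidean norm. For $M>0$ and $x\in\mathbb{R}^d$ the cubic regularized Newton map is $$T_M(x)=\arg\min_{y}\Big\{f(x)+\langle\nabla f(x),y-x\rangle+\tfrac12\langle\nabla^2 f(x)(y-x),y-x\rangle+\tfrac M3\|y-x\|^3\Big\},$$ equivalently $T=T_M(x)$ solves $\nabla f(x)+\nabla^2 f(x)(T-x)+M\|T-x\|(T-x)=0$. Method AccCaCuN (a gradient step $z-\nabla f(z)/\sqrt{M\|\nabla f(z)\|}$ is read as $z$ when $\nabla f(z)=0$): Initialization: $y^0=x^0$. If $f\big(y^0-\frac{\nabla f(y^0)}{\sqrt{M_0\|\nabla f(y^0)\|}}\big)\le f(y^0)-\frac{\sqrt2}{3\sqrt{M_0}}\|\nabla f(y^0)\|^{3/2}$, set $x^1=y^0-\frac{\nabla f(y^0)}{\sqrt{M_0\|\nabla f(y^0)\|}}$; otherwise set $x^1=T_{2H}(x^0)$. Set $\psi_1(x)=f(x^1)+\frac N3\|x-x^0\|^3$. For $k=1,2,\dots$: let $v^k=\arg\min_x\psi_k(x)$ and $y^k=\frac{k}{k+3}x^k+\frac{3}{k+3}v^k$. (a) If $f\big(y^k-\frac{\nabla f(y^k)}{\sqrt{M_k\|\nabla f(y^k)\|}}\big)\le f(y^k)-\frac{1}{\sqrt{3M_k}}\|\nabla f(y^k)\|^{3/2}$, set $x^{k+1}=y^k-\frac{\nabla f(y^k)}{\sqrt{M_k\|\nabla f(y^k)\|}}$ and $\psi_{k+1}(x)=\psi_k(x)+\frac{(k+1)(k+2)}2\big[f(y^k)+\langle\nabla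 f(y^k),x-y^k\rangle\big]$. (b) Otherwise set $x^{k+1}=T_{2H}(y^k)$ and $\psi_{k+1}(x)=\psi_k(x)+\frac{(k+1)(k+2)}2\big[f(x^{k+1})+\langle\nabla f(x^{k+1}),x-x^{k+1}\rangle\big]$. *)

(* Defs.v *)
From HB Require Import structures.
From mathcomp Require Import all_boot all_order all_algebra.
From mathcomp Require Import all_classical all_reals all_analysis.

Set Implicit Arguments.
Unset Strict Implicit.
Unset Printing Implicit Defensive.

Import Order.TTheory GRing.Theory Num.Theory.
Import numFieldNormedType.Exports.

Local Open Scope ring_scope.

Section euclidean_calculus.
Context {R : realType} {d : nat}.
Implicit Types (u v x y z : 'rV[R]_d) (f : 'rV[R]_d -> R).

(* The library norm [`|u|] on ['rV_d] is the sup norm; it is only used through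
   the topology and the bounded sets, which are those of the Euclidean norm. *)
Definition dotp u v : R := \sum_(i < d) u 0 i * v 0 i.

Definition enorm u : R := Num.sqrt (dotp u u).

Definition grad f x : 'rV[R]_d := \row_(i < d) 'D_(delta_mx 0 i) f x.

(* Vectors are rows, so that the Hessian acts by [h *m hess f x], which is
   ['d (grad f) x h] when [grad f] is differentiable at [x]. *)
Definition hess f x : 'M[R]_d := jacobian (grad f) x.

Definition twice_differentiable f : Prop :=
  (forall x, differentiable f x) /\ (forall x, differentiable (grad f) x).

Definition taylor2 f x y : R :=
  f x + dotp (grad f x) (y - x) + 2^-1 * dotp ((y - x) *m hess f x) (y - x).

Definition is_minimizer f x : Prop := forall y, f x <= f y.

(* [is_cubic_newton f M x T] : T = T_M(x) *)
Definition is_cubic_newton f (M : R) x (T : 'rV[R]_d) : Prop :=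
  is_minimizer (fun y => taylor2 f x y + M / 3 * enorm (y - x) ^+ 3) T.

(* When [grad f z = 0] this is [z]. *)
Definition grad_step f (M : R) z : 'rV[R]_d :=
  z - (Num.sqrt (M * enorm (grad f z)))^-1 *: grad f z.

Definition linearization f y x : R := f y + dotp (grad f y) (x - y).

End euclidean_calculus.

(* [x], [y], [v], [psi] form a run of the method started at [x0];
   [v 0] and [psi 0] play no role. *)
Record AccCaCuN {R : realType} {d : nat} (f : 'rV[R]_d -> R) (H N : R)
    (M : nat -> R) (x0 : 'rV[R]_d) (x y v : nat -> 'rV[R]_d)
    (psi : nat -> 'rV[R]_d -> R) : Prop := {
  acc_x0 : x 0%N = x0;
  acc_y0 : y 0%N = x0;
  acc_x1 :
    if f (grad_step f (M 0%N) (y 0%N)) <=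
       f (y 0%N) - Num.sqrt 2 / (3 * Num.sqrt (M 0%N))
                   * enorm (grad f (y 0%N)) `^ (3 / 2)
    then x 1%N = grad_step f (M 0%N) (y 0%N)
    else is_cubic_newton f (2 * H) x0 (x 1%N);
  acc_psi1 : forall z, psi 1%N z = f (x 1%N) + N / 3 * enorm (z - x0) ^+ 3;
  acc_v : forall k, (1 <= k)%N -> is_minimizer (psi k) (v k);
  acc_y : forall k, (1 <= k)%N ->
    y k = (k%:R / k.+3%:R) *: x k + (3 / k.+3%:R) *: v k;
  acc_step : forall k, (1 <= k)%N ->
    if f (grad_step f (M k) (y k)) <=
       f (y k) - (Num.sqrt (3 * M k))^-1 * enorm (grad f (y k)) `^ (3 / 2)
    then x k.+1 = grad_step f (M k) (y k) /\
         forall z, psi k.+1 z =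
           psi k z + (k.+1%:R * k.+2%:R) / 2 * linearization f (y k) z
    else is_cubic_newton f (2 * H) (y k) (x k.+1) /\
         forall z, psi k.+1 z =
           psi k z + (k.+1%:R * k.+2%:R) / 2 * linearization f (x k.+1) z
}.

(* Main.v *)
Require Import Defs.
From HB Require Import structures.
From mathcomp Require Import all_boot all_order all_algebra.
From mathcomp Require Import all_classical all_reals all_analysis.
From mathcomp Require Import ring lra.
Import Order.TTheory GRing.Theory Num.Theory.
Import numFieldNormedType.Exports.
Local Open Scope classical_set_scope.
Local Open Scope ring_scope.

(** The proof is an estimating-sequence argument.  Put A_k = k(k+1)(k+2)/6, so
that A_{k+1} - A_k = (k+1)(k+2)/2 is the weight of the linearization added at
step k, and let R = |x0 - xstar|.  Two inequalities are kept for all k >= 1: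
  A_k f(x_k) <= min psi_k   and   psi_k(xstar) <= A_k f(xstar) + 14/3 H R^3.
As min psi_k <= psi_k(xstar), they give the rate, because 6 * 14/3 = 14 * 2.

The second one is inherited from one step to the next, since by convexity a
linearization lies below f ([linearization_le]).  At k = 1 its constant is
N/3 = 4H plus the initial gap f(x_1) - f(xstar) <= 2/3 H R^3, which is a Young
inequality for the gradient step ([gradient_step_gap]) and the law of cosines
for the Newton step ([residual_gap]).

For the first one, psi_k is an affine function plus N/3 |z - x0|^3, which is
uniformly convex of degree 3, so it exceeds its minimum at v_k by at least
2H |z - v_k|^3 ([cubic_estimate_growth]).  Both branches of the method satisfy
  f(x_{k+1}) + |g|^{3/2} / sqrt (3m) <= f(z) + <g, y_k - z>,   g = grad f z,
where z is the point whose linearization is added: with z = y_k and m = M_k this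
is the test of branch (a), and with z = x_{k+1} and m = H it follows from the
optimality condition of the cubic model ([residual_progress]).  This decrease
pays for the term <g, z' - v_k> which a change of z' away from v_k produces
([estimating_step]); with |g| = 3 m rho^2 all the fractional powers disappear
and only the numerical fact 2 a^3 <= 9 A_{k+1}^2 remains, a = A_{k+1} - A_k.

The optimality condition of the quadratic-plus-cubic model involves the
symmetric part of the Hessian, whereas the bound on the gradient involves the
Hessian itself.  Its symmetry ([hess_sym]) is derived from that bound, by
comparing second differences of f, which are symmetric in the two increments. *)

(** * Euclidean inner product and norm *)

Lemma dotpC {R : realType} {d : nat} (u v : 'rV[R]_d) : dotp u v = dotp v u.
Proof. by apply: eq_bigr => i _; rewrite mulrC. Qed.

Lemma dotpDl {R : realType} {d : nat} (u v w : 'rV[R]_d) :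
  dotp (u + v) w = dotp u w + dotp v w.
Proof. by rewrite /dotp -big_split; apply: eq_bigr => i _; rewrite mxE mulrDl. Qed.

Lemma dotpZl {R : realType} {d : nat} (a : R) (u v : 'rV[R]_d) :
  dotp (a *: u) v = a * dotp u v.
Proof. by rewrite /dotp mulr_sumr; apply: eq_bigr => i _; rewrite mxE mulrA. Qed.

Lemma dotpNl {R : realType} {d : nat} (u v : 'rV[R]_d) : dotp (- u) v = - dotp u v.
Proof. by rewrite -scaleN1r dotpZl mulN1r. Qed.

Lemma dotpDr {R : realType} {d : nat} (u v w : 'rV[R]_d) :
  dotp u (v + w) = dotp u v + dotp u w.
Proof. by rewrite dotpC dotpDl !(dotpC u). Qed.

Lemma dotpZr {R : realType} {d : nat} (a : R) (u v : 'rV[R]_d) :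
  dotp u (a *: v) = a * dotp u v.
Proof. by rewrite dotpC dotpZl (dotpC u). Qed.

Lemma dotpNr {R : realType} {d : nat} (u v : 'rV[R]_d) : dotp u (- v) = - dotp u v.
Proof. by rewrite dotpC dotpNl (dotpC u). Qed.

Lemma dotp0r {R : realType} {d : nat} (u : 'rV[R]_d) : dotp u 0 = 0.
Proof. by rewrite -(scale0r 0) dotpZr mul0r. Qed.

Definition dotpE := (@dotpDl, @dotpDr, @dotpNl, @dotpNr, @dotpZl, @dotpZr).

Lemma dotp_ge0 {R : realType} {d : nat} (u : 'rV[R]_d) : 0 <= dotp u u.
Proof. by apply: sumr_ge0 => i _; rewrite -expr2 sqr_ge0. Qed.

Lemma enorm_ge0 {R : realType} {d : nat} (u : 'rV[R]_d) : 0 <= enorm u.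
Proof. exact: sqrtr_ge0. Qed.

Lemma sqr_enorm {R : realType} {d : nat} (u : 'rV[R]_d) : enorm u ^+ 2 = dotp u u.
Proof. by rewrite sqr_sqrtr// dotp_ge0. Qed.

Lemma dotp_eq0 {R : realType} {d : nat} (u : 'rV[R]_d) : dotp u u = 0 -> u = 0.
Proof.
move=> /eqP; rewrite psumr_eq0; last by move=> i _; rewrite -expr2 sqr_ge0.
move=> /allP u0; apply/rowP => i; rewrite mxE.
by have := u0 i (mem_index_enum i); rewrite /= -expr2 sqrf_eq0 => /eqP.
Qed.

Lemma enormZ {R : realType} {d : nat} (a : R) (u : 'rV[R]_d) :
  enorm (a *: u) = `|a| * enorm u.
Proof.
by rewrite /enorm dotpZl dotpZr mulrA -expr2 sqrtrM ?sqr_ge0// sqrtr_sqr.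
Qed.

Lemma enormN {R : realType} {d : nat} (u : 'rV[R]_d) : enorm (- u) = enorm u.
Proof. by rewrite -scaleN1r enormZ normrN1 mul1r. Qed.

Lemma dotp_le {R : realType} {d : nat} (u v : 'rV[R]_d) :
  dotp u v <= enorm u * enorm v.
Proof.
have [|uv0] := lerP (dotp u v) 0.
  by move=> /le_trans; apply; rewrite mulr_ge0 ?enorm_ge0.
have v0 : 0 < dotp v v.
  rewrite lt_def dotp_ge0 andbT; apply/eqP => /dotp_eq0 v0.
  by rewrite v0 dotp0r ltxx in uv0.
rewrite -(@ler_pXn2r _ 2) ?nnegrE ?(ltW uv0) ?mulr_ge0 ?enorm_ge0//.
rewrite exprMn !sqr_enorm -subr_ge0 -(pmulr_rge0 _ v0).
(* the squared length of v, u combined so as to be orthogonal to v *)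
have := dotp_ge0 (dotp v v *: u - dotp u v *: v); rewrite !dotpE (dotpC v u).
by move=> h; apply: le_trans h _; rewrite le_eqVlt; apply/orP; left; apply/eqP; ring.
Qed.

Lemma normr_dotp_le {R : realType} {d : nat} (u v : 'rV[R]_d) :
  `|dotp u v| <= enorm u * enorm v.
Proof. by rewrite ler_norml dotp_le andbT lerNl -dotpNl -(enormN u) dotp_le. Qed.

Lemma enormD_le {R : realType} {d : nat} (u v : 'rV[R]_d) :
  enorm (u + v) <= enorm u + enorm v.
Proof.
rewrite -(@ler_pXn2r _ 2) ?nnegrE ?addr_ge0 ?enorm_ge0//.
rewrite sqr_enorm !dotpE sqrrD !sqr_enorm (dotpC v u) mulr2n.
by have := dotp_le u v; lra.
Qed.

(** * Scalar inequalities of degree three and four *)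

Lemma young_cubic {R : realFieldType} (x y : R) : 0 <= x -> 0 <= y ->
  3 * x ^+ 2 * y <= 2 * x ^+ 3 + y ^+ 3.
Proof.
move=> x0 y0; rewrite -subr_ge0.
have -> : 2 * x ^+ 3 + y ^+ 3 - 3 * x ^+ 2 * y = (x - y) ^+ 2 * (2 * x + y) by ring.
by rewrite mulr_ge0 ?sqr_ge0//; lra.
Qed.

Lemma young_quartic {R : realFieldType} (x y : R) :
  4 * x ^+ 3 * y <= 3 * x ^+ 4 + y ^+ 4.
Proof.
rewrite -subr_ge0.
have -> : 3 * x ^+ 4 + y ^+ 4 - 4 * x ^+ 3 * y =
  (x - y) ^+ 2 * (2 * x ^+ 2 + (x + y) ^+ 2) by ring.
apply: mulr_ge0; first exact: sqr_ge0.
by have := sqr_ge0 x; have := sqr_ge0 (x + y); lra.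
Qed.

(** The scalar form of the uniform convexity of the cube of a norm: a, b and s are
the sides of a triangle.  As a function of s the part 3as^2 - s^3
increases up to s = 2a and decreases afterwards, so that only the degenerate
triangles s = |a - b| and s = a + b have to be checked. *)
Lemma triangle_cubic_ge0 {R : realFieldType} (a b s : R) :
  0 <= a -> 0 <= b -> 0 <= s -> s <= a + b -> a <= b + s -> b <= a + s ->
  0 <= 2 * b ^+ 3 + a ^+ 3 - 3 * a * b ^+ 2 + 3 * a * s ^+ 2 - s ^+ 3.
Proof.
move=> a0 b0 s0 sab abs bas.
have [s2a|s2a] := lerP s (2 * a).
  (* the increasing range *)
  have mono m : 0 <= m -> m <= s ->
      3 * a * m ^+ 2 - m ^+ 3 <= 3 * a * s ^+ 2 - s ^+ 3.
    move=> m0 ms; rewrite -subr_ge0.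
    have -> : 3 * a * s ^+ 2 - s ^+ 3 - (3 * a * m ^+ 2 - m ^+ 3) =
      (s - m) * (3 / 2 * (s + m) * (2 * a - s) + 2^-1 * (s - m) * (s + 2 * m))
      by field.
    apply: mulr_ge0; first lra.
    by apply: addr_ge0; apply: mulr_ge0; lra.
  have [ab|ba] := lerP a b.
    have /= := mono (b - a) ltac:(lra) ltac:(lra).
    have : 0 <= (b - a) ^+ 2 * (b + 5 * a) by rewrite mulr_ge0 ?sqr_ge0//; lra.
    suff : 2 * b ^+ 3 + a ^+ 3 - 3 * a * b ^+ 2 + (3 * a * (b - a) ^+ 2 - (b - a) ^+ 3) =
       (b - a) ^+ 2 * (b + 5 * a) by lra.
    by ring.
  have /= := mono (a - b) ltac:(lra) ltac:(lra).
  have : 0 <= 3 * (a - b) ^+ 2 * (a + b) by rewrite !mulr_ge0 ?sqr_ge0//; lra.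
  suff : 2 * b ^+ 3 + a ^+ 3 - 3 * a * b ^+ 2 + (3 * a * (a - b) ^+ 2 - (a - b) ^+ 3) =
     3 * (a - b) ^+ 2 * (a + b) by lra.
  by ring.
have -> : 2 * b ^+ 3 + a ^+ 3 - 3 * a * b ^+ 2 + 3 * a * s ^+ 2 - s ^+ 3 =
    (a + b - s) * ((s - 2 * a) * (s + (a + b)) + b * (a + b - s) + s * (b - a)) +
    (b * ((b - 3 / 2 * a) ^+ 2 + 3 / 4 * a ^+ 2) + 3 * a ^+ 3) by field.
have a3 : 0 <= a ^+ 3 by rewrite exprn_ge0.
have a2 : 0 <= a ^+ 2 by rewrite exprn_ge0.
have q2 : 0 <= (b - 3 / 2 * a) ^+ 2 by rewrite sqr_ge0.
apply: addr_ge0.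
  apply: mulr_ge0; first lra.
  by apply: addr_ge0; [apply: addr_ge0|]; apply: mulr_ge0; lra.
by apply: addr_ge0; [apply: mulr_ge0|]; lra.
Qed.

(** The condition on a and B is the sharp one: it says that the minimum over t >= 0
of the right side minus the left one, reached at t = x * sqrt (a / 2), is
nonnegative. *)
Lemma weighted_young_cubic {R : realType} (a B x t : R) :
  0 <= a -> 0 <= B -> 0 <= x -> 0 <= t -> 2 * a ^+ 3 <= 9 * B ^+ 2 ->
  3 * a * x ^+ 2 * t <= 2 * t ^+ 3 + 3 * B * x ^+ 3.
Proof.
move=> a0 B0 x0 t0 aB.
pose w := Num.sqrt (a / 2).
have w0 : 0 <= w by exact: sqrtr_ge0.
have w2 : a = 2 * w ^+ 2 by rewrite sqr_sqrtr; [field|rewrite divr_ge0//; lra].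
have w3 : 4 * w ^+ 3 <= 3 * B.
  rewrite -(@ler_pXn2r _ 2) ?nnegrE ?mulr_ge0 ?exprn_ge0//.
  by move: aB; rewrite w2; lra.
have := young_cubic (w * x) t (mulr_ge0 w0 x0) t0.
have := ler_wpM2r (_ : 0 <= x ^+ 3) w3; rewrite exprn_ge0// => /(_ isT).
by rewrite w2; lra.
Qed.

(** * The cube of the Euclidean norm *)

(** Degree-3 uniform convexity of |.|^3 / 3, whose gradient at u is
[enorm u *: u].  Expressing the inner product by the
three lengths reduces the claim to [triangle_cubic_ge0]. *)
Lemma enorm_cube_uniform_convex {R : realType} {d : nat} (u w : 'rV[R]_d) :
  enorm u ^+ 3 / 3 + enorm u * dotp u (w - u) + enorm (w - u) ^+ 3 / 6 <=
  enorm w ^+ 3 / 3.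
Proof.
have h := @triangle_cubic_ge0 R (enorm u) (enorm w) (enorm (w - u)).
have {h} := h (enorm_ge0 _) (enorm_ge0 _) (enorm_ge0 _) _ _ _.
have -> : enorm (w - u) <= enorm u + enorm w.
  by rewrite addrC -(enormN u) enormD_le.
have -> : enorm u <= enorm w + enorm (w - u).
  by rewrite -(enormN (w - u)) -{1}(subKr w u) enormD_le.
have -> : enorm w <= enorm u + enorm (w - u).
  by rewrite -{1}(subrKC u w) enormD_le.
move=> /(_ erefl erefl erefl).
have wu : enorm (w - u) ^+ 2 = enorm w ^+ 2 - 2 * dotp u (w - u) - enorm u ^+ 2.
  by rewrite !sqr_enorm !dotpE (dotpC w u); ring.
set p := dotp u _ in wu *; set s := enorm (w - u) in wu *.
by rewrite wu -!mulrA; lra.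
Qed.

(** The first-order upper expansion of the cube of the norm, with an explicit
quadratic remainder: it replaces the differentiation of |.|^3, including at 0,
where the norm itself is not differentiable. *)
Lemma enorm_cubeD_le {R : realType} {d : nat} (e h : 'rV[R]_d) (t : R) :
  0 < t <= 1 ->
  enorm (e + t *: h) ^+ 3 <= enorm e ^+ 3 + 3 * t * (enorm e * dotp e h) +
    t ^+ 2 * (enorm h ^+ 2 * (3 * enorm e + enorm h)).
Proof.
move=> /andP[t0 t1].
have a0 := enorm_ge0 e; have k0 := enorm_ge0 h; have b0 := enorm_ge0 (e + t *: h).
have b2 : enorm (e + t *: h) ^+ 2 =
    enorm e ^+ 2 + 2 * t * dotp e h + t ^+ 2 * enorm h ^+ 2.
  by rewrite !sqr_enorm !dotpE (dotpC h e); ring.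
have th : enorm (t *: h) = t * enorm h by rewrite enormZ gtr0_norm.
have ub : enorm (e + t *: h) <= enorm e + t * enorm h by rewrite -th enormD_le.
have lb : enorm e <= enorm (e + t *: h) + t * enorm h.
  by rewrite -th -(enormN (t *: h)) -{1}(addrK (t *: h) e) enormD_le.
move: (enorm e) (enorm h) (enorm (e + t *: h)) (dotp e h) a0 k0 b0 b2 ub lb {th}.
move=> a k b p a0 k0 b0 b2 ub lb.
have tk : t * k <= k by rewrite ler_piMl.
have ba : (b - a) ^+ 2 <= (t * k) ^+ 2.
  have tk0 : 0 <= t * k by rewrite mulr_ge0// ltW.
  rewrite -subr_ge0 subr_sqr mulr_ge0//; lra.
have main : (b - a) ^+ 2 * (b + a / 2) <= (t * k) ^+ 2 * (3 / 2 * a + k).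
  by apply: ler_pM => //; rewrite ?sqr_ge0//; lra.
(* Taylor expansion of c |-> c^(3/2) at a^2, evaluated at b^2 *)
have cube : b ^+ 3 = a ^+ 3 + 3 / 2 * a * (b ^+ 2 - a ^+ 2) + (b - a) ^+ 2 * (b + a / 2).
  by field.
by rewrite cube b2; move: main; rewrite exprMn; nra.
Qed.

(** * First-order conditions for cubic models *)

Lemma first_order_ge0 {R : realFieldType} (c C : R) :
  (forall t, 0 < t <= 1 -> 0 <= t * c + t ^+ 2 * C) -> 0 <= c.
Proof.
move=> tcC; rewrite leNgt; apply/negP => c0.
have C0 : 0 < C by have := tcC 1; rewrite ltr01 lexx expr1n !mul1r => /(_ isT); lra.
(* the minimizer is - c / (2 * C); C - c in place of C keeps t below 1 *)
pose t := - c / (2 * (C - c)).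
have D0 : 0 < 2 * (C - c) by lra.
have t0 : 0 < t by rewrite divr_gt0//; lra.
have t1 : t <= 1 by rewrite ler_pdivrMr//; lra.
have := tcC t; rewrite t0 t1 => /(_ isT).
rewrite expr2 -mulrA -mulrDr pmulr_rge0//.
have : t * (2 * (C - c)) = - c by rewrite divfK// gt_eqF.
by nra.
Qed.

(** Moving from the minimizer e along h changes the model by the left side times t,
up to O(t^2); it is therefore nonnegative, and it is odd in h.  With A = 0 this
also covers the estimating functions. *)
Lemma cubic_model_stationary {R : realType} {d : nat} (l e : 'rV[R]_d)
    (A : 'M[R]_d) (K : R) : 0 <= K ->
  (forall z, dotp l e + 2^-1 * dotp (e *m A) e + K / 3 * enorm e ^+ 3 <=
             dotp l z + 2^-1 * dotp (z *m A) z + K / 3 * enorm z ^+ 3) ->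
  forall h, dotp l h + 2^-1 * (dotp (e *m A) h + dotp (h *m A) e) +
            K * enorm e * dotp e h = 0.
Proof.
move=> K0 emin.
have half h : 0 <= dotp l h + 2^-1 * (dotp (e *m A) h + dotp (h *m A) e) +
    K * enorm e * dotp e h.
  pose C := 2^-1 * dotp (h *m A) h +
    K / 3 * (enorm h ^+ 2 * (3 * enorm e + enorm h)).
  apply: (@first_order_ge0 _ _ C) => t t01.
  have := emin (e + t *: h).
  have := ler_wpM2l (_ : 0 <= K / 3) (enorm_cubeD_le e h t t01).
  move=> /(_ ltac:(lra)).
  rewrite !mulmxDl -!scalemxAl !dotpE /C.
  by move=> h1 h2; have := le_trans h2 (lerD (lexx _) h1); lra.
move=> h; apply/eqP; rewrite eq_le half andbT.
by have := half (- h); rewrite !mulNmx !(dotpNl, dotpNr); lra.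
Qed.

(** * Gradients and symmetry of the Hessian *)

Lemma derive_grad {R : realType} {d : nat} (f : 'rV[R]_d -> R) (a v : 'rV[R]_d) :
  differentiable f a -> 'D_v f a = dotp (grad f a) v.
Proof.
move=> fa; rewrite deriveE// [in LHS](row_sum_delta v) linear_sum.
by apply: eq_bigr => i _; rewrite linearZ mxE deriveE// mulrC.
Qed.

Lemma is_derive_line {R : realType} {d : nat} (f : 'rV[R]_d -> R)
    (a v : 'rV[R]_d) (t : R) : differentiable f (a + t *: v) ->
  is_derive t 1 (fun s => f (a + s *: v)) (dotp (grad f (a + t *: v)) v).
Proof.
move=> fa; rewrite -derive_grad//.
have quot : (fun h => h^-1 *: (((fun s => f (a + s *: v)) \o shift t) (h *: 1) -
      (fun s => f (a + s *: v)) t)) =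
    (fun h => h^-1 *: ((f \o shift (a + t *: v)) (h *: v) - f (a + t *: v))).
  apply/funext => h /=; congr (_ *: (f _ - _)).
  by rewrite [h *: 1]mulr1 scalerDl addrCA.
apply: DeriveDef; last by rewrite /derive quot.
by rewrite /derivable quot; exact: diff_derivable.
Qed.

(** The directional derivative is a limit of difference quotients, each of which is
at most f b - f a by convexity. *)
Lemma linearization_le {R : realType} {d : nat} (f : 'rV[R]_d -> R)
    (a b : 'rV[R]_d) :
  convex_function [set: convex_lmodType 'rV[R]_d] f -> differentiable f a ->
  linearization f a b <= f b.
Proof.
move=> fcvx fa; rewrite /linearization -derive_grad// -lerBrDl.
have fd : derivable f a (b - a) by exact: diff_derivable.
have fcv := cvg_dnbhs_at_right (fd : _ --> _).
rewrite /derive -(cvg_lim (@Rhausdorff R) fcv).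
apply: limr_le; first by apply/cvg_ex; exists ('D_(b - a) f a).
near=> t.
have t0 : 0 < t by near: t; exact: nbhs_right_gt.
have t1 : t <= 1 by near: t; apply: nbhs_right_le.
have h : f (t *: b + (1 - t) *: a) <= t * f b + (1 - t) * f a.
  by apply: (fcvx (Itv01 (ltW t0) t1) b a); rewrite inE.
rewrite -[X in X <= _]/(t^-1 * (f (t *: (b - a) + a) - f a)).
rewrite mulrC ler_pdivrMr//.
have -> : t *: (b - a) + a = t *: b + (1 - t) *: a.
  by rewrite scalerBr scalerBl scale1r -addrA (addrC a).
by lra.
Unshelve. all: by end_near. Qed.

(** The second difference is the increment over [0, 1] of
s |-> f (a + u + s w) - f (a + s w), so the mean value theorem expresses it by
the gradient at two points, where the gradient is replaced by its first-order
expansion at a. *)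
Lemma second_difference {R : realType} {d : nat} (f : 'rV[R]_d -> R)
    (H : R) (a u w : 'rV[R]_d) :
  (forall x, differentiable f x) -> 0 <= H ->
  (forall b, enorm (grad f b - grad f a - (b - a) *m hess f a) <=
             H * enorm (b - a) ^+ 2) ->
  `|f (a + u + w) - f (a + u) - f (a + w) + f a - dotp (u *m hess f a) w| <=
  2 * H * (enorm u + enorm w) ^+ 3.
Proof.
move=> fd H0 fapp.
pose phi (s : R) : R := f (a + u + s *: w) - f (a + s *: w).
pose dphi (s : R) := dotp (grad f (a + u + s *: w)) w - dotp (grad f (a + s *: w)) w.
have phid (s : R) : is_derive s (1 : R) phi (dphi s).
  by apply: is_deriveB; exact: is_derive_line.
have phic : {within `[0, 1], continuous phi}.
  by apply: derivable_within_continuous => s _; exact: ex_derive.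
have [t] := MVT ltr01 (fun s _ => phid s) phic.
rewrite in_itv/= => /andP[/ltW t0 /ltW t1].
rewrite subr0 mulr1 /phi !scale1r !scale0r !addr0 => phiE.
have -> : f (a + u + w) - f (a + u) - f (a + w) + f a = dphi t by rewrite -phiE; ring.
pose E s := grad f s - grad f a - (s - a) *m hess f a.
have uta : a + u + t *: w - a = u + t *: w by rewrite addrC !addrA addNr add0r.
have ta : a + t *: w - a = t *: w by rewrite addrC addKr.
have -> : dphi t - dotp (u *m hess f a) w =
    dotp (E (a + u + t *: w)) w - dotp (E (a + t *: w)) w.
  by rewrite /dphi /E uta ta !mulmxDl !dotpE; ring.
have Ebound s r : enorm (s - a) <= r -> `|dotp (E s) w| <= H * r ^+ 2 * enorm w.
  move=> sr; apply: le_trans (normr_dotp_le _ _) _.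
  apply: ler_wpM2r; first exact: enorm_ge0.
  apply: le_trans (fapp s) _; apply: ler_wpM2l => //.
  by rewrite lerXn2r ?nnegrE ?enorm_ge0// (le_trans (enorm_ge0 _) sr).
have tw : enorm (t *: w) <= enorm w by rewrite enormZ ger0_norm// ler_piMl ?enorm_ge0.
have u0 := enorm_ge0 u; have w0 := enorm_ge0 w.
have E1 := Ebound (a + u + t *: w) (enorm u + enorm w).
have {}E1 := E1 ltac:(by rewrite uta (le_trans (enormD_le _ _))// lerD2l).
have E2 := Ebound (a + t *: w) (enorm u + enorm w).
have {}E2 := E2 ltac:(by rewrite ta (le_trans tw)// lerDr).
apply: le_trans (ler_normB _ _) _; apply: le_trans (lerD E1 E2) _.
rewrite [in leRHS]exprS [leLHS](_ : _ = 2 * H * (enorm w * (enorm u + enorm w) ^+ 2)); last by ring.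
by rewrite ler_wpM2l ?mulr_ge0// ler_wpM2r ?sqr_ge0// lerDr.
Qed.

(** Scaling u and w by t makes the second difference, symmetric in u and w, equal to
t^2 times either side up to O(t^3). *)
Lemma hess_sym {R : realType} {d : nat} (f : 'rV[R]_d -> R)
    (H : R) (a u w : 'rV[R]_d) :
  (forall x, differentiable f x) -> 0 <= H ->
  (forall b, enorm (grad f b - grad f a - (b - a) *m hess f a) <=
             H * enorm (b - a) ^+ 2) ->
  dotp (u *m hess f a) w = dotp (w *m hess f a) u.
Proof.
move=> fd H0 fapp.
suff le u' w' : 0 <= dotp (u' *m hess f a) w' - dotp (w' *m hess f a) u'.
  by have := le u w; have := le w u; lra.
apply: (@first_order_ge0 _ _ (4 * H * (enorm u' + enorm w') ^+ 3)) => t /andP[t0 _].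
rewrite -(pmulr_rge0 _ t0).
have := second_difference f H a (t *: u') (t *: w') fd H0 fapp.
have := second_difference f H a (t *: w') (t *: u') fd H0 fapp.
rewrite -!scalemxAl !dotpE !enormZ (gtr0_norm t0) -!mulrDr (addrC (enorm w')).
rewrite !exprMn (addrAC a (t *: w')).
by rewrite !ler_norml => /andP[h1 h2] /andP[h3 h4]; lra.
Qed.

(** * The cubic Newton step *)

(** Stationarity of the model says that the first-order expansion of the gradient
at T is -K |T - a| (T - a); the bound on the gradient compares it with the
gradient at T.  Everything used about a Newton step is in this inequality. *)
Lemma cubic_newton_residual {R : realType} {d : nat} (f : 'rV[R]_d -> R)
    (H K : R) (a T : 'rV[R]_d) : 0 <= K ->
  (forall u w, dotp (u *m hess f a) w = dotp (w *m hess f a) u) ->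
  enorm (grad f T - grad f a - (T - a) *m hess f a) <= H * enorm (T - a) ^+ 2 ->
  is_cubic_newton f K a T ->
  enorm (grad f T + (K * enorm (T - a)) *: (T - a)) <= H * enorm (T - a) ^+ 2.
Proof.
move=> K0 sym fapp newton.
have stat : forall h, dotp (grad f a) h + 2^-1 * (dotp ((T - a) *m hess f a) h +
    dotp (h *m hess f a) (T - a)) + K * enorm (T - a) * dotp (T - a) h = 0.
  apply: cubic_model_stationary => // z.
  have := newton (z + a); rewrite /taylor2 addrK.
  by rewrite -!addrA lerD2l.
pose G := grad f a + (T - a) *m hess f a + (K * enorm (T - a)) *: (T - a).
have G0 : G = 0.
  apply: dotp_eq0; have := stat G; rewrite (sym G).
  have -> : dotp G G = dotp (grad f a) G + dotp ((T - a) *m hess f a) G +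
      K * enorm (T - a) * dotp (T - a) G by rewrite -dotpZl -!dotpDl.
  by lra.
have -> : grad f T + (K * enorm (T - a)) *: (T - a) =
    grad f T - grad f a - (T - a) *m hess f a + G.
  by rewrite /G -(addrA (grad f T)) -opprD (addrA (grad f T - _)) subrK.
by rewrite G0 addr0.
Qed.

(** With r = |e|, squaring the hypothesis gives
4 H r <g, -e> >= |g|^2 + 3 H^2 r^4, and the right side divided by 4 H r is
smallest at r = |rho|.  For rho >= 0 the conclusion is
<g, -e> >= |g|^{3/2} / sqrt (3H). *)
Lemma residual_progress {R : realType} {d : nat} (H rho : R) (g e : 'rV[R]_d) :
  0 < H -> enorm (g + (2 * H * enorm e) *: e) <= H * enorm e ^+ 2 ->
  enorm g = 3 * H * rho ^+ 2 -> 3 * H * rho ^+ 3 <= dotp g (- e).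
Proof.
move=> H0 res gE; have r0 := enorm_ge0 e.
have : enorm (g + (2 * H * enorm e) *: e) ^+ 2 <= (H * enorm e ^+ 2) ^+ 2.
  by rewrite lerXn2r ?nnegrE ?enorm_ge0// mulr_ge0 ?exprn_ge0// ltW.
rewrite sqr_enorm !dotpE -!sqr_enorm (dotpC e g) gE.
move: res gE r0; set r := enorm e; set p := dotp g e => res gE r0 res2.
have [r1|r1] := eqVneq r 0.
  have e0 : e = 0 by apply: dotp_eq0; rewrite -sqr_enorm -/r r1 expr0n.
  move: res; rewrite r1 mulr0 scale0r addr0 gE expr0n/= mulr0 => rho0.
  have -> : rho = 0.
    by apply/eqP; rewrite -sqrf_eq0 eq_le sqr_ge0 andbT -(pmulr_rle0 _ (_ : 0 < 3 * H))//; lra.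
  by rewrite /p e0 dotp0r oppr0 expr0n/= mulr0.
have rp : 0 < r by rewrite lt_def r1.
have y4 := ler_wpM2l (mulr_ge0 (_ : 0 <= 3) (sqr_ge0 H)) (young_quartic rho r).
have {}y4 := y4 ltac:(lra).
rewrite -(ler_pM2l (_ : 0 < 4 * H * r)); last by rewrite !mulr_gt0.
by lra.
Qed.

(** With r = |T - a|, s = |T - b| and q = |a - b|, the law of cosines turns the
hypothesis into <g, T - b> <= H r (q^2 - r^2 - s^2 + r s), which is at most
H r (q^2 - 3/4 r^2), whose maximum over r is 4/9 H q^3; the 2/3 is the
constant of [gradient_step_gap], for a common bound. *)
Lemma residual_gap {R : realType} {d : nat} (H : R) (g a b T : 'rV[R]_d) :
  0 <= H ->
  enorm (g + (2 * H * enorm (T - a)) *: (T - a)) <= H * enorm (T - a) ^+ 2 ->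
  dotp g (T - b) <= 2 / 3 * H * enorm (a - b) ^+ 3.
Proof.
move=> H0 res.
have r0 := enorm_ge0 (T - a); have s0 := enorm_ge0 (T - b).
have ab0 := enorm_ge0 (a - b).
have cs := le_trans (dotp_le _ (T - b)) (ler_wpM2r s0 res).
have polar : enorm (a - b) ^+ 2 = enorm (T - a) ^+ 2 + enorm (T - b) ^+ 2 -
    2 * dotp (T - a) (T - b).
  have -> : a - b = (T - b) - (T - a) by rewrite opprB [RHS]addrC addrA subrK.
  by rewrite !sqr_enorm; move: (T - b) (T - a) => q p; rewrite !dotpE (dotpC q p); ring.
move: cs; rewrite dotpDl dotpZl.
move: polar r0 s0 ab0.
set r := enorm (T - a); set s := enorm (T - b); set q := enorm (a - b).
set p := dotp (T - a) (T - b); move: (dotp g _) => gT polar r0 s0 ab0 cs.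
have y3 := young_cubic q (3 / 2 * r) ab0 (ltac:(lra) : 0 <= 3 / 2 * r).
have sq : 0 <= H * r * (s - r / 2) ^+ 2 
  by apply: mulr_ge0; [exact: mulr_ge0|exact: sqr_ge0].
have := ler_wpM2l H0 y3.
have : 0 <= H * q ^+ 3 by rewrite mulr_ge0 ?exprn_ge0.
move: cs sq; have -> : p = (r ^+ 2 + s ^+ 2 - q ^+ 2) / 2 by rewrite polar; field.
by lra.
Qed.

(** * The gradient step *)

Lemma powR_three_halves {R : realType} (a : R) : 0 <= a ->
  a `^ (3 / 2) = Num.sqrt a ^+ 3.
Proof. by move=> a0; rewrite mulrC powRrM powR12_sqrt// powR_mulrn ?sqrtr_ge0. Qed.

(** The largest value of g q - sqrt 2 / (3 sqrt m) g^{3/2} over g >= 0, reached at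
g = 2 m q^2. *)
Lemma gradient_step_gap {R : realType} (m g q D : R) :
  0 < m -> 0 <= g -> 0 <= q -> D <= g * q ->
  D - Num.sqrt 2 / (3 * Num.sqrt m) * g `^ (3 / 2) <= 2 / 3 * m * q ^+ 3.
Proof.
move=> m0 g0 q0 Dgq; rewrite powR_three_halves//.
have sm0 : 0 < Num.sqrt m by rewrite sqrtr_gt0.
have s20 : 0 < Num.sqrt (2 : R) by rewrite sqrtr_gt0; lra.
have sm2 : Num.sqrt m ^+ 2 = m by rewrite sqr_sqrtr// ltW.
have s22 : Num.sqrt (2 : R) ^+ 2 = 2 by rewrite sqr_sqrtr//; lra.
pose x := Num.sqrt g / (Num.sqrt 2 * Num.sqrt m).
have x0 : 0 <= x by rewrite divr_ge0 ?sqrtr_ge0// mulr_ge0 ?sqrtr_ge0.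
have gx : Num.sqrt g = x * (Num.sqrt 2 * Num.sqrt m).
  by rewrite divfK// mulf_neq0 ?gt_eqF.
have gE : g = 2 * m * x ^+ 2.
  by rewrite -[LHS]sqr_sqrtr// gx !exprMn s22 sm2; ring.
have -> : Num.sqrt 2 / (3 * Num.sqrt m) * Num.sqrt g ^+ 3 = 4 / 3 * m * x ^+ 3.
  rewrite gx -[in RHS]sm2.
  transitivity (Num.sqrt (2 : R) ^+ 2 ^+ 2 / 3 * Num.sqrt m ^+ 2 * x ^+ 3).
    by field; rewrite gt_eqF.
  by rewrite s22; ring.
have := ler_wpM2l (ltW m0) (young_cubic x q x0 q0).
by move: Dgq; rewrite gE; lra.
Qed.

(** * The estimating sequence *)

(** Convexity bounds f x below by the linearization at z, and the two linearizations
add up to one at y, by the choice of y as a weighted mean of x and v, plus the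
term a <grad f z, w - v>.  The decrease at y and the cubic term compensate the
latter by [weighted_young_cubic]. *)
Lemma estimating_step {R : realType} {d : nat} (f : 'rV[R]_d -> R)
    (H m A a rho fx : R) (z y x v w : 'rV[R]_d) :
  0 < m <= H -> 0 <= A -> 0 <= a -> 0 <= rho ->
  2 * a ^+ 3 <= 9 * (A + a) ^+ 2 ->
  (A + a) *: y = A *: x + a *: v ->
  linearization f z x <= f x ->
  enorm (grad f z) = 3 * m * rho ^+ 2 ->
  fx + 3 * m * rho ^+ 3 <= linearization f z y ->
  (A + a) * fx <= A * f x + 2 * H * enorm (w - v) ^+ 3 + a * linearization f z w.
Proof.
move=> /andP[m0 mH] A0 a0 rho0 aB yE lx gE prog.
have t0 := enorm_ge0 (w - v).
have lin : A * linearization f z x + a * linearization f z w =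
    (A + a) * linearization f z y + a * dotp (grad f z) (w - v).
  have /(congr1 (dotp (grad f z))) := yE; rewrite /linearization !dotpE; lra.
have cs : - (3 * m * rho ^+ 2 * enorm (w - v)) <= dotp (grad f z) (w - v).
  by rewrite -gE; have := normr_dotp_le (grad f z) (w - v); rewrite ler_norml => /andP[].
have y3 := weighted_young_cubic a (A + a) rho (enorm (w - v)) a0 (addr_ge0 A0 a0) rho0 t0 aB.
have {}y3 := ler_wpM2l (ltW m0) y3.
have mH3 : 0 <= (H - m) * enorm (w - v) ^+ 3 by apply: mulr_ge0; [lra|exact: exprn_ge0].
have := ler_wpM2l A0 lx.
have := ler_wpM2l a0 cs.
have := ler_wpM2l (addr_ge0 A0 a0) prog.
by lra.
Qed.

Lemma cubic_estimate_growth {R : realType} {d : nat} (psi : 'rV[R]_d -> R)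
    (N c : R) (l x0 v : 'rV[R]_d) : 0 <= N ->
  (forall z, psi z = c + dotp l (z - x0) + N / 3 * enorm (z - x0) ^+ 3) ->
  is_minimizer psi v ->
  forall z, psi v + N / 6 * enorm (z - v) ^+ 3 <= psi z.
Proof.
move=> N0 psiE vmin z.
have stat : forall h, dotp l h + 2^-1 * (dotp ((v - x0) *m 0) h +
    dotp (h *m 0) (v - x0)) + N * enorm (v - x0) * dotp (v - x0) h = 0.
  apply: cubic_model_stationary => // u.
  have := vmin (u + x0); rewrite !psiE addrK !mulmx0 !(dotpC 0) !dotp0r; lra.
have := stat (z - v); rewrite !mulmx0 !(dotpC 0) !dotp0r.
have zv : z - v = (z - x0) - (v - x0) by rewrite opprB addrA subrK.
have := ler_wpM2l N0 (enorm_cube_uniform_convex (v - x0) (z - x0)).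
rewrite -zv !psiE.
have -> : dotp l (z - v) = dotp l (z - x0) - dotp l (v - x0) by rewrite -dotpNr -dotpDr -zv.
by lra.
Qed.

Theorem theorem4p1 (R : realType) (d : nat) (f : 'rV[R]_d -> R) (H N : R)
    (M : nat -> R) (x0 xstar : 'rV[R]_d) (x y v : nat -> 'rV[R]_d)
    (psi : nat -> 'rV[R]_d -> R)
    (f_convex : convex_function [set: convex_lmodType 'rV[R]_d] f)
    (f_diff2 : twice_differentiable f)
    (H_gt0 : 0 < H)
    (f_upper : forall a b : 'rV[R]_d,
      f b <= taylor2 f a b + H / 3 * enorm (b - a) ^+ 3)
    (grad_approx : forall a b : 'rV[R]_d,
      enorm (grad f b - grad f a - (b - a) *m hess f a) <= H * enorm (b - a) ^+ 2)
    (xstar_min : is_minimizer f xstar)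
    (sublevel_bounded : bounded_set [set z | f z <= f x0])
    (M_bounds : forall k, 0 < M k <= H)
    (N_eq : N = 12 * H)
    (run : AccCaCuN f H N M x0 x y v psi) :
  forall k : nat, (1 <= k)%N ->
    f (x k) - f xstar <=
      14 * (2 * H) * enorm (x0 - xstar) ^+ 3 / (k%:R * k.+1%:R * k.+2%:R).
Proof.
have [fd _] := f_diff2.
have H0 := ltW H_gt0.
have lin_le a b : linearization f a b <= f b by exact: linearization_le.
have residual a T : is_cubic_newton f (2 * H) a T ->
    enorm (grad f T + (2 * H * enorm (T - a)) *: (T - a)) <= H * enorm (T - a) ^+ 2.
  apply: cubic_newton_residual => //; first lra.
  by move=> u w; exact: hess_sym fd H0 (grad_approx a).
pose A (k : nat) : R := k%:R * k.+1%:R * k.+2%:R / 6.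
have A_ge0 k : 0 <= A k by rewrite divr_ge0 ?mulr_ge0.
pose r3 := enorm (x0 - xstar) ^+ 3.
have r30 : 0 <= r3 by rewrite exprn_ge0 ?enorm_ge0.
have init : f (x 1%N) - f xstar <= 2 / 3 * H * r3.
  have := acc_x1 run; rewrite (acc_y0 run); case: ifP => [dec ->|_ newton].
    have gap : f x0 - f xstar <= enorm (grad f x0) * enorm (x0 - xstar).
      have := lin_le x0 xstar; have := dotp_le (grad f x0) (x0 - xstar).
      by rewrite /linearization -(opprB x0) dotpNr; lra.
    have /andP[M0 MH] := M_bounds 0%N.
    have := gradient_step_gap _ _ _ _ M0 (enorm_ge0 _) (enorm_ge0 _) gap.
    have := ler_wpM2r r30 MH; rewrite -/r3; lra.
  have := residual_gap H _ x0 xstar _ H0 (residual _ _ newton).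
  have := lin_le (x 1%N) xstar.
  by rewrite /linearization -(opprB (x 1%N) xstar) dotpNr -/r3; lra.
have inv k : (1 <= k)%N ->
    [/\ exists c l, forall z, psi k z =
          c + dotp l (z - x0) + N / 3 * enorm (z - x0) ^+ 3,
        A k * f (x k) <= psi k (v k) &
        psi k xstar <= A k * f xstar + 14 / 3 * H * r3].
  elim: k => // -[_ _|k IH _].
    have A1 : A 1%N = 1 by rewrite /A; field.
    split.
    - by exists (f (x 1%N)), 0 => z; rewrite (acc_psi1 run) dotpC dotp0r addr0.
    - rewrite A1 mul1r (acc_psi1 run) N_eq lerDl.
      by rewrite mulr_ge0 ?exprn_ge0 ?enorm_ge0//; lra.
    - rewrite A1 mul1r (acc_psi1 run) N_eq -enormN opprB -/r3; lra.
  have {IH} [//|[c [l psiE]] low up] := IH.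
  set j := k.+1 in c l psiE low up *.
  have j1 : (1 <= j)%N by [].
  move: j j1 c l psiE low up => {k} j j1 c l psiE low up.
  have n0 : 0 <= j%:R :> R by exact: ler0n.
  have n1 : j.+1%:R = j%:R + 1 :> R by rewrite -addn1 natrD.
  have n2 : j.+2%:R = j%:R + 2 :> R by rewrite -addn2 natrD.
  have n3 : j.+3%:R = j%:R + 3 :> R by rewrite -addn3 natrD.
  have /andP[M0 MH] := M_bounds j.
  pose a : R := j.+1%:R * j.+2%:R / 2.
  have a0 : 0 <= a by rewrite divr_ge0 ?mulr_ge0.
  have Aa : A j.+1 = A j + a by rewrite /A /a n1 n2 n3; field.
  have aA : 2 * a ^+ 3 <= 9 * (A j + a) ^+ 2.
    rewrite -Aa /A /a n1 n2 n3; move: (j%:R : R) n0 => n n0.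
    rewrite -subr_ge0; set q := (n + 1) * (n + 2).
    have -> : 9 * (q * (n + 3) / 6) ^+ 2 - 2 * (q / 2) ^+ 3 =
      q ^+ 2 * (3 * n + 7) / 4 by rewrite /q; field.
    by rewrite divr_ge0 ?mulr_ge0 ?sqr_ge0//; lra.
  have yE : (A j + a) *: y j = A j *: x j + a *: v j.
    rewrite (acc_y run)// scalerDr !scalerA -Aa /A /a n1 n2 n3.
    by congr (_ *: _ + _ *: _); field; rewrite gt_eqF//; lra.
  have N0 : 0 <= N by rewrite N_eq; lra.
  have grow := cubic_estimate_growth _ _ _ _ _ _ N0 psiE (acc_v run j1).
  (* One invariant step for both branches: z is the point whose linearization is
     added, and rho is |grad f z| in the scale where the decrease is a cube. *)
  have step z m :
      (forall p, psi j.+1 p = psi j p + a * linearization f z p) ->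
      0 < m <= H ->
      (forall rho, 0 <= rho -> enorm (grad f z) = 3 * m * rho ^+ 2 ->
         f (x j.+1) + 3 * m * rho ^+ 3 <= linearization f z (y j)) ->
      [/\ exists c l, forall z, psi j.+1 z =
          c + dotp l (z - x0) + N / 3 * enorm (z - x0) ^+ 3,
        A j.+1 * f (x j.+1) <= psi j.+1 (v j.+1) &
        psi j.+1 xstar <= A j.+1 * f xstar + 14 / 3 * H * r3].
    move=> psiS m0H prog; have /andP[m0 _] := m0H.
    pose rho := Num.sqrt (enorm (grad f z) / (3 * m)).
    have rho0 : 0 <= rho by exact: sqrtr_ge0.
    have m3 : 0 < 3 * m by lra.
    have rhoE : enorm (grad f z) = 3 * m * rho ^+ 2.
      by rewrite sqr_sqrtr ?divr_ge0 ?enorm_ge0 ?(ltW m3)// mulrC divfK ?gt_eqF.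
    split.
    - exists (c + a * (f z + dotp (grad f z) (x0 - z))), (l + a *: grad f z) => p.
      rewrite psiS psiE /linearization.
      by rewrite !dotpE; ring.
    - rewrite Aa psiS.
      have := estimating_step f H m (A j) a rho (f (x j.+1)) z (y j) (x j) (v j)
        (v j.+1) m0H (A_ge0 j) a0 rho0 aA yE (lin_le _ _) rhoE (prog _ rho0 rhoE).
      by have := grow (v j.+1); rewrite N_eq; lra.
    - rewrite Aa psiS; have := ler_wpM2l a0 (lin_le z xstar); lra.
  have := acc_step run j1; case: ifP => [dec [xE psiS]|_ [newton psiS]].
    apply: (step _ (M j) psiS (M_bounds j)) => rho rho0 gE.
    rewrite /linearization subrr dotp0r addr0 -lerBrDr xE.
    apply: le_trans dec _; rewrite lerD2l lerN2 powR_three_halves ?enorm_ge0//.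
    set s := Num.sqrt (3 * M j).
    have s0 : 0 < s by rewrite sqrtr_gt0; lra.
    have s2 : s ^+ 2 = 3 * M j by rewrite sqr_sqrtr//; lra.
    rewrite gE -s2 -exprMn sqrtr_sqr ger0_norm; last by rewrite mulr_ge0// ltW.
    rewrite le_eqVlt; apply/orP; left; apply/eqP.
    by field; rewrite gt_eqF.
  apply: (step _ H psiS) => [|rho rho0 gE]; first by rewrite H_gt0 lexx.
  rewrite /linearization lerD2l -opprB.
  exact: residual_progress (residual _ _ newton) gE.
move=> k k1; have [[c [l psiE]] low up] := inv k k1.
have Ak : 0 < k%:R * k.+1%:R * k.+2%:R :> R by rewrite !mulr_gt0 ?ltr0n.
have := le_trans low (le_trans (acc_v run k1 xstar) up).
rewrite ler_pdivlMr// -/r3 /A; lra.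
Qed.
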